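(* For a mixed graph $G$ let $\Theta(G)=\sum_{G'\in\mathcal{O}_{ac}(G)}G'$ (zero if $\mathcal{O}_{ac}(G)=\emptyset$). Then $\Theta$ is a morphism of double twisted bialgebras from $\mathbf{G}$ to $\mathbf{G}_{aco}$; that is, for all finite sets: $\Theta(GH)=\Theta(G)\Theta(H)$ for mixed graphs $G,H$ on disjoint vertex sets and $\Theta(1)=1$; $(\Theta\otimes\Theta)\circ\Delta_{I,J}(G)=\Delta_{I,J}\circ\Theta(G)$ for every mixed graph $G$ with $V(G)=I\sqcup J$; $(\Theta\otimes\Theta)\circ\delta_\sim(G)=\delta^{ac}_\sim\circ\Theta(G)$ for every mixed graph $G$ and every equivalence $\sim$ on $V(G)$; and $\Theta$ is compatible with the counits.
   Context: A mixed graph $G$ has a finite vertex set $V(G)$, edges $E(G)$ (2-element subsets) and arcs $A(G)$ (ordered pairs of distinct vertices), no pair being both an edge and carrying an arc; it is oriented if $E(G)=\emptyset$, and acyclic if it has no oriented cycle $x_0\to\cdots\to x_n=x_0$, $n\geq2$, along arcs. An orientation of $G$ is an oriented graph $H$ with $V(H)=V(G)$ and $A(H)=A(G)\sqcup E'$, where $E'$ contains, for each edge $\{x,y\}\in E(G)$, exactly one of $(x,y),(y,x)$; $\mathcal{O}_{ac}(G)$ is the set of acyclic orientations. $\mathbf{G}[X]$ (resp. $\mathbf{G}_{aco}[X]$) is spanned by mixed graphs (resp. acyclic oriented graphs) with vertex set $X$. Product: disjoint union. $\Delta_{I,J}(G)=G_{\mid I}\otimes G_{\mid J}$ if $J$ is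 an ideal of $G$ (i.e. $y\in J$, $(y,z)\in A(G)\Rightarrow z\in J$), $0$ otherwise. $\mathcal{E}^c[G]$: equivalences whose classes induce connected subgraphs (ignoring orientation). $G\mid\sim$ keeps only edges/arcs inside classes; $G/\sim$ has the classes as vertices, arcs $(\mathrm{cl}(x),\mathrm{cl}(y))$ for arcs $(x,y)$ between distinct classes, and edges between distinct classes coming from edges of $G$ when no arc of $G/\sim$ joins them. On $\mathbf{G}$: $\delta_\sim(G)=G/\sim\otimes G\mid\sim$ if $\sim\in\mathcal{E}^c[G]$, else $0$. On $\mathbf{G}_{aco}$: $\delta^{ac}_\sim(H)=H/\sim\otimes H\mid\sim$ if $\sim\in\mathcal{E}^c[H]$ and $H/\sim$ is acyclic, else $0$. Counits: $\varepsilon_\Delta(1)=1$; $\epsilon_\delta(G)=1$ if $E(G)=A(G)=\emptyset$, else $0$. *)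

(* Defs.v *)
From HB Require Import structures.
From mathcomp Require Import all_boot all_algebra.

Set Implicit Arguments.
Unset Strict Implicit.
Unset Printing Implicit Defensive.

Import GRing.Theory.
Local Open Scope ring_scope.

(* A pair (edges, arcs): edges are 2-element sets, arcs are ordered pairs of
   distinct vertices, and no pair both is an edge and carries an arc. Opposite
   arcs (x, y) and (y, x) may coexist. *)
Definition mixed_graph_axiom (T : finType)
    (p : {set {set T}} * {set T * T}) : bool :=
  [&& [forall e in p.1, #|e| == 2%N],
      [forall a in p.2, a.1 != a.2] &
      [forall a in p.2, [set a.1; a.2] \notin p.1]].

Record mixed_graph (T : finType) := MixedGraph {
  mg_val : {set {set T}} * {set T * T};
  _ : mixed_graph_axiom mg_val
}.
HB.instance Definition _ (T : finType) := [isSub for @mg_val T].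
HB.instance Definition _ (T : finType) := [Finite of mixed_graph T by <:].

Section MixedGraph.
Variable T : finType.
Implicit Type G : mixed_graph T.

Definition edges G : {set {set T}} := (mg_val G).1.
Definition arcs G : {set T * T} := (mg_val G).2.

Definition is_arc G : rel T := fun x y => (x, y) \in arcs G.
Definition is_edge G : rel T := fun x y => [set x; y] \in edges G.

Lemma card_edge G e : e \in edges G -> #|e| = 2%N.
Proof. by case/and3P: (valP G) => /forall_inP H _ _ /H /eqP. Qed.

Lemma arc_neq G a : a \in arcs G -> a.1 != a.2.
Proof. by case/and3P: (valP G) => _ /forall_inP H _ /H. Qed.

Lemma arc_not_edge G a : a \in arcs G -> [set a.1; a.2] \notin edges G.
Proof. by case/and3P: (valP G) => _ _ /forall_inP H /H. Qed.

Lemma mixed_graph_intro (E : {set {set T}}) (A : {set T * T}) :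
    (forall e, e \in E -> #|e| = 2%N) ->
    (forall a, a \in A -> a.1 != a.2) ->
    (forall a, a \in A -> [set a.1; a.2] \notin E) ->
  mixed_graph_axiom (E, A).
Proof.
move=> hE hA hEA; apply/and3P; split; apply/forall_inP => //.
by move=> e /hE /eqP.
Qed.

Definition mk_mixed_graph (E : {set {set T}}) (A : {set T * T})
    (h1 : forall e, e \in E -> #|e| = 2%N)
    (h2 : forall a, a \in A -> a.1 != a.2)
    (h3 : forall a, a \in A -> [set a.1; a.2] \notin E) : mixed_graph T :=
  MixedGraph (mixed_graph_intro h1 h2 h3).

Definition oriented G : bool := edges G == set0.

(* The list [:: x_0; ...; x_(n-1)] stands for x_0 -> ... -> x_(n-1) -> x_0. *)
Definition acyclic G : Prop :=
  forall c : seq T, (1 < size c)%N -> ~~ cycle (is_arc G) c.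

Lemma acyclic_dec G : decidable (acyclic G).
Proof.
apply: (@decP _ (~~ [exists x, exists y, is_arc G x y && connect (is_arc G) y x])).
apply: (iffP idP) => [/existsPn nG [|x [|y c]] //= _|acG].
  apply/negP => /andP[xy yc]; have /existsPn/(_ y) := nG x; case/negP.
  by rewrite xy; apply/connectP; exists (rcons c x); rewrite ?last_rcons.
apply/existsPn => x; apply/existsPn => y; apply/negP => /andP[xy].
case/connectP=> p yp xE; have := acG (y :: p) => /=.
rewrite rcons_path yp -xE xy; case: p {yp} xE => [/= xE|z p _] => [_|/(_ isT)//].
by have := arc_neq xy; rewrite /= xE eqxx.
Qed.

Definition acyclicb G : bool := acyclic_dec G.

Lemma acyclicP G : reflect (acyclic G) (acyclicb G).
Proof. exact: sumboolP. Qed.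

Definition adjacent G : rel T :=
  fun x y => [|| is_edge G x y, is_arc G x y | is_arc G y x].

Definition connected G : bool :=
  [forall x, forall y, connect (adjacent G) x y].

Definition is_ideal G (J : {set T}) : bool :=
  [forall y, forall z, (y \in J) && is_arc G y z ==> (z \in J)].

Definition is_orientation G (H : mixed_graph T) : bool :=
  oriented H &&
  [exists E' : {set T * T},
    [&& [forall a in E', is_edge G a.1 a.2],
        [forall x, forall y, is_edge G x y ==> ((x, y) \in E') (+) ((y, x) \in E')],
        [disjoint arcs G & E'] &
        arcs H == arcs G :|: E']].

End MixedGraph.

Lemma acyclic_homo (S T : finType) (G : mixed_graph S) (H : mixed_graph T)
    (h : S -> T) :
  (forall x y, is_arc G x y -> is_arc H (h x) (h y)) -> acyclic H -> acyclic G.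
Proof.
move=> hom acH c c_gt1; apply: contra (acH (map h c) _); last by rewrite size_map.
exact: homo_cycle.
Qed.

Section Empty.
Variable T : finType.
Fact mg_empty_axiom : mixed_graph_axiom (set0, set0 : {set T * T}).
Proof. by apply: mixed_graph_intro => ?; rewrite inE. Qed.
Definition mg_empty : mixed_graph T := MixedGraph mg_empty_axiom.
End Empty.

Definition mg_one : mixed_graph void := mg_empty void.

Section Relabel.
Variables (S T : finType) (f : S -> T) (injf : injective f).
Variable G : mixed_graph S.

Definition relabel_edges : {set {set T}} := [set f @: (e : {set S}) | e in edges G].
Definition relabel_arcs : {set T * T} := [set (f a.1, f a.2) | a in arcs G].

Fact relabel_edges2 e : e \in relabel_edges -> #|e| = 2%N.
Proof. by case/imsetP=> e' /card_edge e'2 ->; rewrite card_imset. Qed.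

Fact relabel_arcs_neq a : a \in relabel_arcs -> a.1 != a.2.
Proof. by case/imsetP=> b /arc_neq ab -> /=; rewrite (inj_eq injf). Qed.

Fact relabel_arcs_edges a :
  a \in relabel_arcs -> [set a.1; a.2] \notin relabel_edges.
Proof.
case/imsetP=> b /arc_not_edge ab -> /=.
have -> : [set f b.1; f b.2] = f @: [set b.1; b.2] by rewrite imsetU1 imset_set1.
apply: contra ab => /imsetP[e eG].
by move/(imset_inj injf) ->.
Qed.

Definition mg_relabel : mixed_graph T :=
  mk_mixed_graph relabel_edges2 relabel_arcs_neq relabel_arcs_edges.

End Relabel.

Section Product.
Variables (X Y : finType) (G : mixed_graph X) (H : mixed_graph Y).

Let injl : injective (@inl X Y). Proof. by move=> ? ? []. Qed.
Let injr : injective (@inr X Y). Proof. by move=> ? ? []. Qed.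

Definition prod_edges : {set {set X + Y}} :=
  relabel_edges inl G :|: relabel_edges inr H.
Definition prod_arcs : {set (X + Y) * (X + Y)} :=
  relabel_arcs inl G :|: relabel_arcs inr H.

Fact prod_edges2 e : e \in prod_edges -> #|e| = 2%N.
Proof. by case/setUP; [apply: (relabel_edges2 injl)|apply: (relabel_edges2 injr)]. Qed.

Fact prod_arcs_neq a : a \in prod_arcs -> a.1 != a.2.
Proof. by case/setUP; [apply: (relabel_arcs_neq injl)|apply: (relabel_arcs_neq injr)]. Qed.

Fact prod_arcs_edges a : a \in prod_arcs -> [set a.1; a.2] \notin prod_edges.
Proof.
case/setUP=> aG; rewrite inE negb_or.
  rewrite (relabel_arcs_edges injl aG) /=; case/imsetP: aG => b _ -> /=.
  apply/imsetP => -[e _] /setP/(_ (inl b.1)); rewrite !inE eqxx /=.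
  by move/esym/imsetP => -[].
rewrite (relabel_arcs_edges injr aG) andbT; case/imsetP: aG => b _ -> /=.
apply/imsetP => -[e _] /setP/(_ (inr b.1)); rewrite !inE eqxx /=.
by move/esym/imsetP => -[].
Qed.

Definition mg_prod : mixed_graph (X + Y)%type :=
  mk_mixed_graph prod_edges2 prod_arcs_neq prod_arcs_edges.

End Product.

Section Induced.
Variables (T : finType) (G : mixed_graph T) (I : {set T}).

Definition ind_edges : {set {set {x : T | x \in I}}} :=
  [set e : {set {x : T | x \in I}} | val @: e \in edges G].
Definition ind_arcs : {set {x : T | x \in I} * {x : T | x \in I}} :=
  [set a | (val a.1, val a.2) \in arcs G].

Fact ind_edges2 e : e \in ind_edges -> #|e| = 2%N.
Proof. by rewrite inE => /card_edge; rewrite card_imset //; apply: val_inj. Qed.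

Fact ind_arcs_neq a : a \in ind_arcs -> a.1 != a.2.
Proof. by rewrite inE => /arc_neq; rewrite (inj_eq val_inj). Qed.

Fact ind_arcs_edges a : a \in ind_arcs -> [set a.1; a.2] \notin ind_edges.
Proof. by rewrite !inE => /arc_not_edge; rewrite imsetU !imset_set1. Qed.

Definition mg_induced : mixed_graph {x : T | x \in I} :=
  mk_mixed_graph ind_edges2 ind_arcs_neq ind_arcs_edges.

End Induced.

(* Meaningful when [r] is an equivalence relation; the definitions do not
   need it. *)
Section Equivalence.
Variables (T : finType) (r : rel T).

Definition classes : finType :=
  {C : {set T} | C \in equivalence_partition r [set: T]}.

Definition cl (x : T) : classes :=
  exist _ [set y in [set: T] | r x y]
    (imset_f (fun x => [set y in [set: T] | r x y]) (in_setT x)).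

Variable G : mixed_graph T.

Definition connected_classes : bool :=
  [forall C : classes, connected (mg_induced G (val C))].

Definition quo_arcs : {set classes * classes} :=
  [set (cl a.1, cl a.2) | a in arcs G & cl a.1 != cl a.2].
Definition quo_edges : {set {set classes}} :=
  [set e | [exists x, exists y,
    [&& e == [set cl x; cl y], is_edge G x y, cl x != cl y,
        (cl x, cl y) \notin quo_arcs & (cl y, cl x) \notin quo_arcs]]].

Fact quo_edges2 e : e \in quo_edges -> #|e| = 2%N.
Proof.
rewrite inE => /existsP[x /existsP[y /and5P[/eqP-> _ xy _ _]]].
by rewrite cards2 xy.
Qed.

Fact quo_arcs_neq a : a \in quo_arcs -> a.1 != a.2.
Proof. by case/imsetP=> b; rewrite inE => /andP[_ ab] ->. Qed.

Fact quo_arcs_edges a : a \in quo_arcs -> [set a.1; a.2] \notin quo_edges.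
Proof.
move=> aA; have a12 := quo_arcs_neq aA; rewrite inE.
apply/existsP => -[x /existsP[y /and5P[/eqP/setP eqa _ xy nxy nyx]]].
have /esym := eqa a.1; have /esym := eqa a.2; rewrite !inE !eqxx orbT /=.
case: a aA a12 {eqa} => u v /= aA uv /orP[]/eqP ev /orP[]/eqP eu.
- by rewrite eu ev eqxx in uv.
- by rewrite eu ev (negPf nyx) in aA.
- by rewrite eu ev (negPf nxy) in aA.
- by rewrite eu ev eqxx in uv.
Qed.

Definition mg_quo : mixed_graph classes :=
  mk_mixed_graph quo_edges2 quo_arcs_neq quo_arcs_edges.

Definition restr_edges : {set {set T}} :=
  [set e in edges G | [forall x in e, forall y in e, r x y]].
Definition restr_arcs : {set T * T} := [set a in arcs G | r a.1 a.2].

Fact restr_edges2 e : e \in restr_edges -> #|e| = 2%N.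
Proof. by rewrite inE => /andP[/card_edge]. Qed.

Fact restr_arcs_neq a : a \in restr_arcs -> a.1 != a.2.
Proof. by rewrite inE => /andP[/arc_neq]. Qed.

Fact restr_arcs_edges a : a \in restr_arcs -> [set a.1; a.2] \notin restr_edges.
Proof. by rewrite !inE => /andP[/arc_not_edge/negPf ->]. Qed.

Definition mg_restr : mixed_graph T :=
  mk_mixed_graph restr_edges2 restr_arcs_neq restr_arcs_edges.

End Equivalence.

Record aco_graph (T : finType) := AcoGraph {
  aco_val : mixed_graph T;
  _ : oriented aco_val && acyclicb aco_val
}.
HB.instance Definition _ (T : finType) := [isSub for @aco_val T].
HB.instance Definition _ (T : finType) := [Finite of aco_graph T by <:].

Definition mk_aco (T : finType) (G : mixed_graph T)
    (oG : oriented G) (aG : acyclic G) : aco_graph T :=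
  AcoGraph (introT andP (conj oG (introT (acyclicP G) aG))).

Section AcoTheory.
Variables (T : finType) (H : aco_graph T).
Lemma aco_oriented : oriented (aco_val H). Proof. by case/andP: (valP H). Qed.
Lemma aco_acyclic : acyclic (aco_val H).
Proof. by case/andP: (valP H) => _ /acyclicP. Qed.
Lemma aco_edges : edges (aco_val H) = set0. Proof. exact/eqP/aco_oriented. Qed.
End AcoTheory.

Fact mg_one_oriented : oriented mg_one. Proof. exact: eqxx. Qed.
Fact mg_one_acyclic : acyclic mg_one. Proof. by case=> [//|[]]. Qed.
Definition aco_one : aco_graph void := mk_aco mg_one_oriented mg_one_acyclic.

Section AcoRelabel.
Variables (S T : finType) (f : S -> T) (bijf : bijective f) (H : aco_graph S).

Fact relabel_oriented : oriented (mg_relabel (bij_inj bijf) (aco_val H)).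
Proof. by rewrite /oriented /edges /= /relabel_edges aco_edges imset0. Qed.

Fact relabel_acyclic : acyclic (mg_relabel (bij_inj bijf) (aco_val H)).
Proof.
case: (bijf) => g fK gK; apply: (@acyclic_homo _ _ _ (aco_val H) g); last exact: aco_acyclic.
by move=> x y /imsetP[[u v] uv [-> ->]]; rewrite !fK.
Qed.

Definition aco_relabel : aco_graph T := mk_aco relabel_oriented relabel_acyclic.
End AcoRelabel.

Section AcoProduct.
Variables (X Y : finType) (G : aco_graph X) (H : aco_graph Y).

Fact prod_oriented : oriented (mg_prod (aco_val G) (aco_val H)).
Proof.
by rewrite /oriented /edges /= /prod_edges /relabel_edges !aco_edges !imset0 setU0.
Qed.

Fact prod_acyclic : acyclic (mg_prod (aco_val G) (aco_val H)).
Proof.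
set P := mg_prod _ _.
have arcl x z : is_arc P (inl x) z -> exists2 y, z = inl y & is_arc (aco_val G) x y.
  by case/setUP=> /imsetP[[u v] uv //= [-> ->]]; exists v.
have arcr x z : is_arc P (inr x) z -> exists2 y, z = inr y & is_arc (aco_val H) x y.
  by case/setUP=> /imsetP[[u v] uv //= [-> ->]]; exists v.
have pathl p x : path (is_arc P) (inl x) p ->
    exists2 q, p = map inl q & path (is_arc (aco_val G)) x q.
  elim: p x => [|z p IH] x /=; first by exists [::].
  case/andP=> /arcl[y -> xy] /IH[q -> yq]; exists (y :: q) => //=.
  by rewrite xy.
have pathr p x : path (is_arc P) (inr x) p ->
    exists2 q, p = map inr q & path (is_arc (aco_val H)) x q.
  elim: p x => [|z p IH] x /=; first by exists [::].
  case/andP=> /arcr[y -> xy] /IH[q -> yq]; exists (y :: q) => //=.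
  by rewrite xy.
move=> [//|z p] p_gt0; apply/negP; case: z p_gt0 => x p_gt0 /=.
  case/pathl=> q; case/lastP: q => [|q y]; first by case: (p).
  rewrite map_rcons => /rcons_inj[pE [<-]] xq.
  apply: (negP _ xq); apply: (@aco_acyclic _ G (x :: q)).
  by move: p_gt0; rewrite pE /= size_map.
case/pathr=> q; case/lastP: q => [|q y]; first by case: (p).
rewrite map_rcons => /rcons_inj[pE [<-]] xq.
apply: (negP _ xq); apply: (@aco_acyclic _ H (x :: q)).
by move: p_gt0; rewrite pE /= size_map.
Qed.

Definition aco_prod : aco_graph (X + Y)%type := mk_aco prod_oriented prod_acyclic.
End AcoProduct.

Section AcoInduced.
Variables (T : finType) (H : aco_graph T) (I : {set T}).

Fact induced_oriented : oriented (mg_induced (aco_val H) I).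
Proof. by apply/eqP/setP => e; rewrite /edges /= /ind_edges !inE aco_edges inE. Qed.

Fact induced_acyclic : acyclic (mg_induced (aco_val H) I).
Proof.
apply: (@acyclic_homo _ _ _ (aco_val H) val); last exact: aco_acyclic.
by move=> x y; rewrite /is_arc /arcs /= inE.
Qed.

Definition aco_induced : aco_graph {x : T | x \in I} :=
  mk_aco induced_oriented induced_acyclic.
End AcoInduced.

Section AcoEquivalence.
Variables (T : finType) (r : rel T) (H : aco_graph T).

Fact restr_oriented : oriented (mg_restr r (aco_val H)).
Proof. by apply/eqP/setP => e; rewrite /edges /= /restr_edges !inE aco_edges inE. Qed.

Fact restr_acyclic : acyclic (mg_restr r (aco_val H)).
Proof.
apply: (@acyclic_homo _ _ _ (aco_val H) id); last exact: aco_acyclic.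
by move=> x y; rewrite /is_arc /arcs /= inE => /andP[].
Qed.

Definition aco_restr : aco_graph T := mk_aco restr_oriented restr_acyclic.

Fact quo_oriented : oriented (mg_quo r (aco_val H)).
Proof.
apply/eqP/setP => e; rewrite /edges /= !inE; apply/existsP => -[x /existsP[y]].
by rewrite /is_edge aco_edges inE andbF.
Qed.

Definition aco_quo (aq : acyclic (mg_quo r (aco_val H))) : aco_graph (classes r) :=
  mk_aco quo_oriented aq.
End AcoEquivalence.

(* The tensor product of [freemod K A] and [freemod K B] is represented by
   [freemod K (A * B)], the pair (a, b) standing for a (x) b. *)
Notation freemod K A := {ffun A -> K^o}.

Section FreeModule.
Variable K : fieldType.

Definition basis (A : finType) (a : A) : freemod K A := [ffun x => (x == a)%:R].

Definition lin_ext (A : finType) (V : lmodType K) (f : A -> V)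
    (u : freemod K A) : V := \sum_a u a *: f a.

Fact lin_ext_is_linear (A : finType) (V : lmodType K) (f : A -> V) :
  linear (lin_ext f).
Proof.
move=> k u v; rewrite /lin_ext scaler_sumr -big_split /=.
by apply: eq_bigr => a _; rewrite !ffunE scalerDl scalerA.
Qed.
HB.instance Definition _ (A : finType) (V : lmodType K) (f : A -> V) :=
  GRing.isLinear.Build K (freemod K A) V *:%R (lin_ext f) (lin_ext_is_linear f).

Definition tens (A B : finType) (u : freemod K A) (v : freemod K B) :
  freemod K (A * B)%type := [ffun p => u p.1 * v p.2].

Definition tens_map (A A' B B' : finType)
    (f : {linear freemod K A -> freemod K A'}) (g : {linear freemod K B -> freemod K B'}) :
    {linear freemod K (A * B)%type -> freemod K (A' * B')%type} :=
  lin_ext (fun p : A * B => tens (f (basis p.1)) (g (basis p.2))).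

End FreeModule.

Section Bialgebras.
Variable K : fieldType.

Definition G_relabel (S T : finType) (f : S -> T) (bijf : bijective f) :
    {linear freemod K (mixed_graph S) -> freemod K (mixed_graph T)} :=
  lin_ext (fun G => basis K (mg_relabel (bij_inj bijf) G)).

Definition Gaco_relabel (S T : finType) (f : S -> T) (bijf : bijective f) :
    {linear freemod K (aco_graph S) -> freemod K (aco_graph T)} :=
  lin_ext (fun H => basis K (aco_relabel bijf H)).

Definition G_mul (X Y : finType) :
    {linear freemod K (mixed_graph X * mixed_graph Y)%type
       -> freemod K (mixed_graph (X + Y)%type)} :=
  lin_ext (fun p : mixed_graph X * mixed_graph Y => basis K (mg_prod p.1 p.2)).

Definition Gaco_mul (X Y : finType) :
    {linear freemod K (aco_graph X * aco_graph Y)%type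
       -> freemod K (aco_graph (X + Y)%type)} :=
  lin_ext (fun p : aco_graph X * aco_graph Y => basis K (aco_prod p.1 p.2)).

(* Meant for I and J complementary. *)
Definition G_Delta (T : finType) (I J : {set T}) :
    {linear freemod K (mixed_graph T)
       -> freemod K (mixed_graph {x | x \in I} * mixed_graph {x | x \in J})%type} :=
  lin_ext (fun G =>
    if is_ideal G J then basis K (mg_induced G I, mg_induced G J) else 0).

Definition Gaco_Delta (T : finType) (I J : {set T}) :
    {linear freemod K (aco_graph T)
       -> freemod K (aco_graph {x | x \in I} * aco_graph {x | x \in J})%type} :=
  lin_ext (fun H =>
    if is_ideal (aco_val H) J then basis K (aco_induced H I, aco_induced H J) else 0).

(* Meant for r an equivalence; H / r is automatically oriented. *)
Definition G_delta (T : finType) (r : rel T) :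
    {linear freemod K (mixed_graph T)
       -> freemod K (mixed_graph (classes r) * mixed_graph T)%type} :=
  lin_ext (fun G =>
    if connected_classes r G then basis K (mg_quo r G, mg_restr r G) else 0).

Definition Gaco_delta (T : finType) (r : rel T) :
    {linear freemod K (aco_graph T)
       -> freemod K (aco_graph (classes r) * aco_graph T)%type} :=
  lin_ext (fun H =>
    if connected_classes r (aco_val H) then
      match acyclic_dec (mg_quo r (aco_val H)) with
      | left aq => basis K (aco_quo aq, aco_restr r H)
      | right _ => 0
      end
    else 0).

(* The counit of Delta vanishes outside the component of the empty set. *)
Definition G_eps_Delta (T : finType) : {linear freemod K (mixed_graph T) -> K^o} :=
  lin_ext (fun _ => (#|T| == 0%N)%:R : K^o).

Definition Gaco_eps_Delta (T : finType) : {linear freemod K (aco_graph T) -> K^o} :=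
  lin_ext (fun _ => (#|T| == 0%N)%:R : K^o).

Definition G_eps_delta (T : finType) : {linear freemod K (mixed_graph T) -> K^o} :=
  lin_ext (fun G => ((edges G == set0) && (arcs G == set0))%:R : K^o).

Definition Gaco_eps_delta (T : finType) : {linear freemod K (aco_graph T) -> K^o} :=
  lin_ext (fun H =>
    ((edges (aco_val H) == set0) && (arcs (aco_val H) == set0))%:R : K^o).

Definition Theta (T : finType) :
    {linear freemod K (mixed_graph T) -> freemod K (aco_graph T)} :=
  lin_ext (fun G => \sum_(H : aco_graph T | is_orientation G (aco_val H)) basis K H).

End Bialgebras.

(* Main.v *)
(* For an acyclic oriented graph H, being an orientation of G amounts to: H
   contains the arcs of G and H has the same adjacency relation as G. Adjacency
   behaves functorially under relabelling, product, restriction and quotient,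
   so each identity, evaluated at a basis element, becomes a bijection.
   For Delta, an orientation H of G having J as an ideal is determined by its
   restrictions to I and J, as every adjacent pair between I and J must point
   from I to J. For delta, if H / ~ is acyclic, all arcs of H between two given
   classes point the same way, so H is determined by H / ~ and H | ~.
   Conversely, gluing acyclic pieces gives an acyclic graph because the rank
   functions of the pieces combine lexicographically. *)

Require Import Defs.
From HB Require Import structures.
From mathcomp Require Import all_boot all_algebra.

Set Implicit Arguments.
Unset Strict Implicit.
Unset Printing Implicit Defensive.

Import GRing.Theory.
Local Open Scope ring_scope.

(** * Adjacency, and acyclicity through rank functions *)

Section Adjacency.
Variable T : finType.
Implicit Type G : mixed_graph T.

Lemma is_edgeC G x y : is_edge G x y = is_edge G y x.
Proof. by rewrite /is_edge setUC. Qed.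

Lemma is_arc_neq G x y : is_arc G x y -> x != y.
Proof. exact: arc_neq. Qed.

Lemma is_arc_not_edge G x y : is_arc G x y -> ~~ is_edge G x y.
Proof. exact: arc_not_edge. Qed.

Lemma adjacentC G x y : adjacent G x y = adjacent G y x.
Proof. by rewrite /adjacent is_edgeC [is_arc G x y || _]orbC. Qed.

Lemma arc_adjacent G x y : is_arc G x y -> adjacent G x y.
Proof. by rewrite /adjacent => ->; rewrite orbT. Qed.

(** Since edges and arcs exclude each other, adjacency and arcs together determine the edges.
    Orientations can therefore be described by these two relations alone. *)
Lemma edgeE G x y :
  is_edge G x y = [&& adjacent G x y, ~~ is_arc G x y & ~~ is_arc G y x].
Proof.
rewrite /adjacent; case xy: (is_arc G x y).
  by rewrite andbF; apply/negbTE/is_arc_not_edge.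
case yx: (is_arc G y x); last by rewrite !orbF andbT.
by rewrite !andbF is_edgeC; apply/negbTE/is_arc_not_edge.
Qed.

Lemma acyclic_arcC G x y : acyclic G -> is_arc G x y -> ~~ is_arc G y x.
Proof.
by move=> acG xy; have := acG [:: x; y] isT; rewrite /= xy andbT.
Qed.

(** The rank of a vertex is the number of vertices from which it can be reached. Along an arc from
    [x] to [y] this set grows, and strictly so: it gains [y], which cannot reach [x] without closing
    a cycle. The bound is what makes lexicographic combinations of ranks possible. *)
Lemma acyclic_rank G : acyclic G ->
  exists2 rk : T -> nat, (forall x, (rk x <= #|T|)%N) &
    forall x y, is_arc G x y -> (rk x < rk y)%N.
Proof.
move=> acG; exists (fun x => #|[set z | connect (is_arc G) z x]|).
  by move=> x; apply: max_card.
move=> x y xy; apply/proper_card/properP; split.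
  apply/subsetP=> z; rewrite !inE => zx.
  by apply: connect_trans zx (connect1 xy).
exists y; rewrite !inE ?connect0 //; apply/negP=> /connectP[p yp xE].
have := acG (y :: p); rewrite /= rcons_path yp -xE xy.
case: p {yp} xE => [/= xE|z p _ /(_ isT)//] _.
by have := is_arc_neq xy; rewrite xE eqxx.
Qed.

(** Going once around a cycle, the rank would strictly increase from [rk x] to itself. *)
Lemma rank_acyclic G (rk : T -> nat) :
  (forall x y, is_arc G x y -> (rk x < rk y)%N) -> acyclic G.
Proof.
move=> rkG [|x c] // _; apply/negP=> /= cyc.
have: path ltn (rk x) (map rk (rcons c x)).
  by rewrite path_map; apply: sub_path cyc => ? ?; apply: rkG.
move/(order_path_min ltn_trans)/allP/(_ (rk x)).
by rewrite map_f ?mem_rcons ?mem_head // ltnn => /(_ isT).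
Qed.

End Adjacency.

(** * Acyclic oriented graphs as relations, and a criterion for orientations *)

Section AcoGraphs.
Variable T : finType.
Implicit Types (G : mixed_graph T) (H : aco_graph T).

Lemma aco_is_edge H x y : is_edge (aco_val H) x y = false.
Proof. by rewrite /is_edge aco_edges inE. Qed.

Lemma aco_adjacent H x y :
  adjacent (aco_val H) x y = is_arc (aco_val H) x y || is_arc (aco_val H) y x.
Proof. by rewrite /adjacent aco_is_edge. Qed.

Lemma oriented_eq (G1 G2 : mixed_graph T) : oriented G1 -> oriented G2 ->
  is_arc G1 =2 is_arc G2 -> G1 = G2.
Proof.
move=> /eqP e1 /eqP e2 e12; apply: val_inj.
rewrite /= [mg_val G1]surjective_pairing [mg_val G2]surjective_pairing.
rewrite -!/(edges _) -!/(arcs _) e1 e2; congr pair.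
by apply/setP=> -[x y]; apply: e12.
Qed.

Lemma aco_eq (H1 H2 : aco_graph T) :
  is_arc (aco_val H1) =2 is_arc (aco_val H2) -> H1 = H2.
Proof. by move=> e; apply/val_inj/oriented_eq => //; apply: aco_oriented. Qed.

(** The construction tool for all existence proofs below: an orientation is given by its arc
    relation, and a rank increasing along it secures both irreflexivity and acyclicity. *)
Lemma aco_of_rank (e : rel T) (rk : T -> nat) :
  (forall x y, e x y -> (rk x < rk y)%N) ->
  exists H, is_arc (aco_val H) =2 e.
Proof.
move=> rkP; pose A := [set a | e a.1 a.2].
have h1 (s : {set T}) : s \in (set0 : {set {set T}}) -> #|s| = 2%N by rewrite inE.
have h2 a : a \in A -> a.1 != a.2.
  by rewrite inE => /rkP; apply: contraTneq => ->; rewrite ltnn.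
have h3 a : a \in A -> [set a.1; a.2] \notin (set0 : {set {set T}}) by rewrite in_set0.
pose G := mk_mixed_graph h1 h2 h3.
have GE : is_arc G =2 e by move=> x y; rewrite /is_arc /arcs /= inE.
have acG : acyclic G by apply: (rank_acyclic (rk := rk)) => x y; rewrite GE; apply: rkP.
by exists (mk_aco (eqxx _ : oriented G) acG).
Qed.

(* The exclusive choice for each edge comes for free: an acyclic graph has no
   2-cycle. *)
Lemma is_orientationP G H :
  reflect (subrel (is_arc G) (is_arc (aco_val H)) /\
           adjacent (aco_val H) =2 adjacent G)
          (is_orientation G (aco_val H)).
Proof.
rewrite /is_orientation aco_oriented /=.
apply: (iffP existsP) => [[E /and4P[/forall_inP EG /forallP xorE _ /eqP HE]]|].
  have HGE x y : is_arc (aco_val H) x y = is_arc G x y || ((x, y) \in E).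
    by rewrite /is_arc HE inE.
  split=> [x y|x y]; first by rewrite HGE => ->.
  rewrite aco_adjacent !HGE /adjacent; case xy: (is_edge G x y) => /=.
    have /forallP/(_ y) := xorE x; rewrite xy.
    by do 2!case: (_ \in E); rewrite ?orbT.
  have /negPf -> : (x, y) \notin E by apply/negP=> /EG; rewrite xy.
  have /negPf -> : (y, x) \notin E by apply/negP=> /EG; rewrite is_edgeC xy.
  by rewrite !orbF.
case=> GH adjE; have acH := @acyclic_arcC _ _ _ _ (aco_acyclic H).
exists [set a in arcs (aco_val H) | is_edge G a.1 a.2]; apply/and4P; split.
- by apply/forall_inP=> a; rewrite inE => /andP[].
- apply/forallP=> x; apply/forallP=> y; apply/implyP=> xy.
  rewrite !inE /= (is_edgeC G y x) xy !andbT -!/(is_arc _ _ _).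
  have: adjacent (aco_val H) x y by rewrite adjE /adjacent xy.
  by rewrite aco_adjacent => /orP[] h; rewrite h (negPf (acH _ _ h)).
- rewrite -setI_eq0; apply/eqP/setP=> -[x y]; rewrite !inE /=.
  by apply/and3P=> -[/is_arc_not_edge /negPf ->].
apply/eqP/setP=> -[x y]; rewrite !inE /= edgeE -adjE.
rewrite -!/(is_arc _ x y); apply/idP/orP=> [xy|[/GH //|/andP[]//]].
(* An arc of [H] that is not an arc of [G] comes from an edge of [G]: the opposite arc in [G] would
   also lie in [H] and close a 2-cycle. *)
case: (boolP (is_arc G x y)) => xyG; [by left | right].
rewrite xy (arc_adjacent xy) /=.
by apply/negP=> /GH yx; have := acH _ _ xy; rewrite yx.
Qed.

End AcoGraphs.

(** * Arcs, edges and adjacency under relabelling, product and restriction to a subset *)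

Lemma relabel_is_arc (S T : finType) (f : S -> T) (injf : injective f) G x y :
  is_arc (mg_relabel injf G) (f x) (f y) = is_arc G x y.
Proof.
apply/imsetP/idP=> [[[u v] uv [/injf -> /injf ->]] //|xy].
by exists (x, y).
Qed.

Lemma relabel_is_edge (S T : finType) (f : S -> T) (injf : injective f) G x y :
  is_edge (mg_relabel injf G) (f x) (f y) = is_edge G x y.
Proof.
have fxy : [set f x; f y] = f @: [set x; y] by rewrite imsetU1 imset_set1.
rewrite /is_edge {1}/edges /= /relabel_edges fxy.
by rewrite mem_imset //; apply: imset_inj.
Qed.

Lemma relabel_adjacent (S T : finType) (f : S -> T) (injf : injective f) G x y :
  adjacent (mg_relabel injf G) (f x) (f y) = adjacent G x y.
Proof. by rewrite /adjacent !relabel_is_arc relabel_is_edge. Qed.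

Section Product.
Variables (X Y : finType) (G : mixed_graph X) (H : mixed_graph Y).
Local Notation GH := (mg_prod G H).

Lemma prod_is_arc u v : is_arc GH u v =
  match u, v with
  | inl x, inl x' => is_arc G x x'
  | inr y, inr y' => is_arc H y y'
  | _, _ => false
  end.
Proof.
apply/setUP/idP=> [[]/imsetP[[a b] ab [-> ->]] //|].
case: u v => [x|y] [x'|y'] // h; [left | right]; apply/imsetP.
  by exists (x, x').
by exists (y, y').
Qed.

Lemma prod_is_edge u v : is_edge GH u v =
  match u, v with
  | inl x, inl x' => is_edge G x x'
  | inr y, inr y' => is_edge H y y'
  | _, _ => false
  end.
Proof.
have imset2 (Z : finType) (f : Z -> (X + Y)%type) z z' :
  f @: [set z; z'] = [set f z; f z'] by rewrite imsetU1 imset_set1.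
have injl : injective (@inl X Y) by move=> ? ? [].
have injr : injective (@inr X Y) by move=> ? ? [].
(* These two facts rule out mixed pairs: the image of an edge under one injection contains no point
   of the other summand. *)
have inlF (e : {set X}) y : (inr y \in @inl X Y @: e) = false by apply/imsetP=> -[].
have inrF (e : {set Y}) x : (inl x \in @inr X Y @: e) = false by apply/imsetP=> -[].
have edgesP (w : {set X + Y}) : reflect
    ((exists2 e, e \in edges G & w = inl @: e) \/
     (exists2 e, e \in edges H & w = inr @: e)) (w \in edges GH).
  by apply: (iffP setUP) => -[/imsetP|/imsetP]; [left | right | left | right].
apply/edgesP/idP=> [[][e eE /setP euv]|].
- case: u v euv => [x|y] [x'|y'] euv.
  + have eE' : @inl X Y @: [set x; x'] = inl @: e by rewrite imset2; apply/setP.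
    by rewrite /is_edge (imset_inj injl eE').
  + by have := euv (inr y'); rewrite inlF !inE eqxx orbT.
  + by have := euv (inr y); rewrite inlF !inE eqxx.
  + by have := euv (inr y); rewrite inlF !inE eqxx.
- case: u v euv => [x|y] [x'|y'] euv.
  + by have := euv (inl x); rewrite inrF !inE eqxx.
  + by have := euv (inl x); rewrite inrF !inE eqxx.
  + by have := euv (inl x'); rewrite inrF !inE eqxx orbT.
  + have eE' : @inr X Y @: [set y; y'] = inr @: e by rewrite imset2; apply/setP.
    by rewrite /is_edge (imset_inj injr eE').
case: u v => [x|y] [x'|y'] // h; [left; exists [set x; x']|right; exists [set y; y']];
  by rewrite ?imset2.
Qed.

Lemma prod_adjacent u v : adjacent GH u v =
  match u, v with
  | inl x, inl x' => adjacent G x x'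
  | inr y, inr y' => adjacent H y y'
  | _, _ => false
  end.
Proof. by rewrite /adjacent !prod_is_arc prod_is_edge; case: u v => [?|?] []. Qed.

End Product.

Section Induced.
Variables (T : finType) (G : mixed_graph T) (I : {set T}).

Lemma induced_is_arc u v : is_arc (mg_induced G I) u v = is_arc G (val u) (val v).
Proof. by rewrite /is_arc {1}/arcs /= inE. Qed.

Lemma induced_is_edge u v : is_edge (mg_induced G I) u v = is_edge G (val u) (val v).
Proof. by rewrite /is_edge {1}/edges /= inE imsetU1 imset_set1. Qed.

Lemma induced_adjacent u v :
  adjacent (mg_induced G I) u v = adjacent G (val u) (val v).
Proof. by rewrite /adjacent !induced_is_arc induced_is_edge. Qed.

End Induced.

(** * Quotient and restriction along an equivalence *)

Section Quotient.
Variables (T : finType) (r : rel T).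
Hypothesis eqr : equivalence_rel r.
Implicit Type G : mixed_graph T.

Lemma equivalence_refl x : r x x.
Proof. by have [] := eqr x x x. Qed.

Lemma equivalence_sym x y : r x y = r y x.
Proof.
have [_ tr] := (equivalence_relP r).1 eqr.
by apply/idP/idP=> /tr <-; apply: equivalence_refl.
Qed.

Lemma cl_eq x y : (cl r x == cl r y) = r x y.
Proof.
rewrite -val_eqE; apply/eqP/idP=> [/setP/(_ y)|xy].
  by rewrite !inE equivalence_refl.
by apply/setP=> z; rewrite !inE; have [_ ->] := eqr x y z.
Qed.

Lemma quo_is_arcP G C D :
  reflect (exists x y, [/\ C = cl r x, D = cl r y, C != D & is_arc G x y])
          (is_arc (mg_quo r G) C D).
Proof.
apply: (iffP imsetP) => [[[x y]]|[x [y [-> -> xy Gxy]]]].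
  by rewrite inE => /andP[Gxy xy] [-> ->]; exists x, y.
by exists (x, y); rewrite // inE; apply/andP.
Qed.

(** An edge is discarded in the quotient only when an arc already joins the two classes, so
    discarding it does not affect adjacency. Hence adjacency in the quotient depends only on
    adjacency in [G]. *)
Lemma quo_adjacentP G C D :
  reflect (exists x y, [/\ C = cl r x, D = cl r y, C != D & adjacent G x y])
          (adjacent (mg_quo r G) C D).
Proof.
apply: (iffP idP) => [/or3P[||]|[x [y [Cx Dy CD]]]].
(* The equality of unordered pairs is exploited through membership of [C], [D], [cl r x] and
   [cl r y], which leaves the two possible matchings. *)
- rewrite /is_edge inE => /existsP[x /existsP[y /and5P[/eqP/setP E xy ne _ _]]].
  have := E C; have := E D; rewrite !inE !eqxx orbT => /esym D2 /esym C2.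
  have CD : C != D.
    have := E (cl r x); have := E (cl r y); rewrite !inE !eqxx orbT.
    case: (C =P D) => // ->; rewrite !orbb => /eqP yD /eqP xD.
    by rewrite xD yD eqxx in ne.
  case/orP: C2 CD => /eqP-> CD; case/orP: D2 CD => /eqP-> CD.
  + by rewrite eqxx in CD.
  + by exists x, y; rewrite /adjacent xy.
  + by exists y, x; rewrite /adjacent is_edgeC xy.
  + by rewrite eqxx in CD.
- by case/quo_is_arcP=> x [y [Cx Dy CD xy]]; exists x, y; rewrite arc_adjacent.
- case/quo_is_arcP=> x [y [Cx Dy CD xy]]; exists y, x.
  by rewrite eq_sym adjacentC arc_adjacent.
case CDa: (is_arc (mg_quo r G) C D); first by rewrite /adjacent CDa orbT.
case DCa: (is_arc (mg_quo r G) D C); first by rewrite /adjacent DCa !orbT.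
rewrite /adjacent CDa DCa !orbF => /or3P[xy|xy|yx].
- rewrite /is_edge inE; apply/existsP; exists x; apply/existsP; exists y.
  by rewrite -Cx -Dy eqxx xy CD; move: CDa DCa; rewrite /is_arc /arcs /= => -> ->.
- by case/negP: (negbT CDa); apply/quo_is_arcP; exists x, y.
- by case/negP: (negbT DCa); apply/quo_is_arcP; exists y, x; rewrite eq_sym.
Qed.

Lemma restr_is_arc G x y : is_arc (mg_restr r G) x y = is_arc G x y && r x y.
Proof. by rewrite /is_arc {1}/arcs /= inE. Qed.

Lemma restr_is_edge G x y : is_edge (mg_restr r G) x y = is_edge G x y && r x y.
Proof.
rewrite /is_edge {1}/edges /= inE; congr (_ && _).
apply/forall_inP/idP=> [/(_ x)|xy].
  by rewrite set21 => /(_ isT)/forall_inP/(_ y); rewrite set22 => /(_ isT).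
move=> u /set2P[]->; apply/forall_inP=> v /set2P[]->;
  by rewrite ?equivalence_refl // equivalence_sym.
Qed.

Lemma restr_adjacent G x y :
  adjacent (mg_restr r G) x y = adjacent G x y && r x y.
Proof.
rewrite /adjacent !restr_is_arc restr_is_edge (equivalence_sym y x).
by rewrite -!andb_orl.
Qed.

(** Connectedness of classes ignores orientation, so a graph and its orientations pass the same
    test. *)
Lemma connected_classes_adjacent G1 G2 :
  adjacent G1 =2 adjacent G2 -> connected_classes r G1 = connected_classes r G2.
Proof.
move=> e12; apply: eq_forallb => C; apply: eq_forallb => x; apply: eq_forallb => y.
by apply: eq_connect => u v; rewrite !induced_adjacent.
Qed.

End Quotient.

(** * Coefficients of [Theta] and of linear extensions *)

Section FreeModuleTheory.
Variable K : fieldType.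

(* The codomain is [K^o] rather than [K] because unifying the two ring
   structures on [n%:R] is prohibitively slow. *)
Lemma sum_indicator (A : finType) (P R : pred A) (b : bool) :
  (forall x y, P x -> P y -> R x -> R y -> x = y) ->
  b = [exists x, P x && R x] ->
  \sum_(x | P x) (R x)%:R = b%:R :> K^o.
Proof.
move=> uniqR ->; case: existsP => [[x /andP[Px Rx]]|noR].
  rewrite (bigD1 x) //= Rx big1 ?addr0 // => y /andP[Py /negPf xy].
  by case Ry: (R y) => //; rewrite (uniqR y x) ?eqxx in xy.
by rewrite big1 // => x Px; case Rx: (R x) => //; case: noR; exists x; rewrite Px.
Qed.

Lemma lin_ext_basis (A : finType) (V : lmodType K) (f : A -> V) a :
  lin_ext f (basis K a) = f a.
Proof.
rewrite /lin_ext (bigD1 a) //= ffunE eqxx scale1r big1 ?addr0 // => b /negPf ba.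
by rewrite ffunE ba scale0r.
Qed.

Lemma tens_basis (A B : finType) (a : A) (b : B) :
  tens (basis K a) (basis K b) = basis K (a, b).
Proof. by apply/ffunP=> -[a' b']; rewrite !ffunE -natrM mulnb. Qed.

Lemma tens_map_basis (A A' B B' : finType)
    (f : {linear freemod K A -> freemod K A'})
    (g : {linear freemod K B -> freemod K B'}) a b :
  tens_map f g (basis K (a, b)) = tens (f (basis K a)) (g (basis K b)).
Proof. by rewrite /tens_map /= lin_ext_basis. Qed.

Variable T : finType.
Implicit Types (G : mixed_graph T) (H : aco_graph T).

(** Reduces each compatibility below to comparing coefficients: an indicator on one side, a count of
    orientations on the other. *)
Lemma Theta_basisE G H :
  Theta K T (basis K G) H = (is_orientation G (aco_val H))%:R.
Proof.
rewrite /Theta /= lin_ext_basis sum_ffunE.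
under eq_bigr do rewrite ffunE eq_sym.
apply: sum_indicator => [x y _ _ /eqP-> /eqP-> //|].
apply/idP/existsP=> [GH|[H' /andP[GH' /eqP <-]] //].
by exists H; rewrite GH eqxx.
Qed.

Lemma lin_ext_Theta (V : lmodType K) (f : aco_graph T -> V) G :
  lin_ext f (Theta K T (basis K G)) =
    \sum_(H : aco_graph T | is_orientation G (aco_val H)) f H.
Proof.
rewrite /lin_ext [RHS]big_mkcond; apply: eq_bigr => H _.
by rewrite Theta_basisE; case: ifP; rewrite ?scale1r ?scale0r.
Qed.

End FreeModuleTheory.

(** * Compatibility of [Theta] with relabelling, products, coproducts and counits *)

Section Compatibility.
Variable K : fieldType.

Lemma Theta_relabel (S T : finType) (f : S -> T) (bijf : bijective f)
    (G : mixed_graph S) :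
  Theta K T (G_relabel K bijf (basis K G))
  = Gaco_relabel K bijf (Theta K S (basis K G)).
Proof.
have injf := bij_inj bijf; apply/ffunP=> H.
rewrite /G_relabel /= lin_ext_basis Theta_basisE.
rewrite /Gaco_relabel /= lin_ext_Theta sum_ffunE.
under eq_bigr do rewrite ffunE.
have arcE (H' : aco_graph S) x y :
  is_arc (aco_val (aco_relabel bijf H')) (f x) (f y) = is_arc (aco_val H') x y.
  by rewrite relabel_is_arc.
(* The pattern of all the proofs below: at most one orientation contributes to the coefficient, and
   one exists exactly when the other side is 1. *)
apply/esym/sum_indicator => [H1 H2 _ _ /eqP HE1 /eqP HE2|].
  by apply: aco_eq => x y; rewrite -!arcE -HE1 -HE2.
have [g fK gK] := bijf.
apply/is_orientationP/existsP=> [[arcGH adjGH]|]; last first.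
  case=> H' /= /andP[/is_orientationP[arcGH adjGH] /eqP HE].
  rewrite HE; split=> x y; rewrite -(gK x) -(gK y).
    by rewrite relabel_is_arc arcE; apply: arcGH.
  by rewrite !relabel_adjacent.
(* The preimage of [H] is its pullback along [f], and a rank for it is pulled back as well. *)
have [rk _ rkH] := acyclic_rank (@aco_acyclic _ H).
have [H' H'E] := @aco_of_rank S (fun x y => is_arc (aco_val H) (f x) (f y))
  (rk \o f) (fun x y => rkH (f x) (f y)).
exists H'; apply/andP; split.
  apply/is_orientationP; split=> x y; rewrite ?aco_adjacent !H'E.
    by rewrite -(relabel_is_arc injf); apply: arcGH.
  by rewrite -aco_adjacent adjGH relabel_adjacent.
apply/eqP/aco_eq => x y; rewrite -(gK x) -(gK y) arcE H'E.
by rewrite !gK.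
Qed.

Lemma Theta_mul (X Y : finType) (G : mixed_graph X) (H : mixed_graph Y) :
  Theta K (X + Y)%type (G_mul K X Y (tens (basis K G) (basis K H)))
  = Gaco_mul K X Y (tens (Theta K X (basis K G)) (Theta K Y (basis K H))).
Proof.
apply/ffunP=> L.
rewrite /G_mul /= tens_basis lin_ext_basis Theta_basisE /=.
rewrite /Gaco_mul /= /lin_ext sum_ffunE.
pose P (p : aco_graph X * aco_graph Y) :=
  is_orientation G (aco_val p.1) && is_orientation H (aco_val p.2).
(* The tensor of the two images has coefficient 1 at pairs of orientations and 0 elsewhere, so the
   sum restricts to such pairs. *)
transitivity (\sum_(p | P p) (L == aco_prod p.1 p.2)%:R : K^o); last first.
  rewrite [LHS]big_mkcond; apply: eq_bigr => p _; rewrite !ffunE !Theta_basisE.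
  rewrite -natrM mulnb -/(P p); case: (P p); first by rewrite [RHS]mul1r.
  by rewrite [RHS]mul0r.
apply/esym/sum_indicator => [[A B] [A' B'] _ _ /eqP /= LE /eqP LE'|].
  have E u v : is_arc (aco_val (aco_prod A B)) u v
      = is_arc (aco_val (aco_prod A' B')) u v.
    by rewrite -LE LE'.
  congr pair; apply: aco_eq => x y.
    by have := E (inl x) (inl y); rewrite !prod_is_arc.
  by have := E (inr x) (inr y); rewrite !prod_is_arc.
apply/is_orientationP/existsP=> [[arcL adjL]|]; last first.
  case=> -[A B] /andP[/andP[]].
  move=> /is_orientationP[arcA adjA] /is_orientationP[arcB adjB] /eqP ->.
  split=> u v; rewrite !(prod_is_arc, prod_adjacent).
    by case: u v => [x|y] [x'|y'] //; [apply: arcA | apply: arcB].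
  by case: u v => [x|y] [x'|y'].
have [rk _ rkL] := acyclic_rank (@aco_acyclic _ L).
have [A AE] := @aco_of_rank X (fun x y => is_arc (aco_val L) (inl x) (inl y))
  (rk \o inl) (fun x y => rkL (inl x) (inl y)).
have [B BE] := @aco_of_rank Y (fun x y => is_arc (aco_val L) (inr x) (inr y))
  (rk \o inr) (fun x y => rkL (inr x) (inr y)).
exists (A, B); apply/andP; split.
  apply/andP; split; apply/is_orientationP; split=> x y; rewrite /= ?aco_adjacent ?AE ?BE.
  - by move=> xy; apply: arcL; rewrite prod_is_arc.
  - by rewrite -aco_adjacent adjL prod_adjacent.
  - by move=> xy; apply: arcL; rewrite prod_is_arc.
  - by rewrite -aco_adjacent adjL prod_adjacent.
apply/eqP/aco_eq => u v; rewrite prod_is_arc /=.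
(* An orientation of the product has the adjacency of the product, hence no arc between the
   summands; it is the product of its two parts. *)
have cross x y : ~~ adjacent (aco_val L) (inl x) (inr y) by rewrite adjL prod_adjacent.
case: u v => [x|y] [x'|y'] //; apply/negbTE.
  by apply: contra (cross x y'); apply: arc_adjacent.
by apply: contra (cross x' y); rewrite adjacentC; apply: arc_adjacent.
Qed.

Lemma Theta_one : Theta K void (basis K mg_one) = basis K aco_one.
Proof.
apply/ffunP=> H; rewrite Theta_basisE ffunE.
have -> : H = aco_one by apply: aco_eq => -[].
by rewrite eqxx; case: is_orientationP => // -[]; split=> -[].
Qed.

(** [H] has at least the arcs of [G], so being closed under arcs is a stronger condition in [H].
    When [J] is not an ideal of [G], no orientation contributes to the coproduct. *)
Lemma orientation_ideal (T : finType) (J : {set T}) (G : mixed_graph T)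
    (H : aco_graph T) :
  is_orientation G (aco_val H) -> is_ideal (aco_val H) J -> is_ideal G J.
Proof.
case/is_orientationP=> GH _ /forallP idJ; apply/forallP=> x; apply/forallP=> y.
apply/implyP=> /andP[xJ /GH xy].
by have /forallP/(_ y)/implyP := idJ x; apply; rewrite xJ.
Qed.

Lemma Theta_Delta (T : finType) (I J : {set T}) (G : mixed_graph T) :
  I :|: J = [set: T] -> [disjoint I & J] ->
  tens_map (Theta K {x | x \in I}) (Theta K {x | x \in J})
    (G_Delta K I J (basis K G))
  = Gaco_Delta K I J (Theta K T (basis K G)).
Proof.
move=> IJ dIJ.
have inIJ x : (x \in I) || (x \in J) by have := in_setT x; rewrite -IJ inE.
have notIJ x : x \in I -> x \in J -> False.
  by move=> xI xJ; case/negP: (disjointFr dIJ xI).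
rewrite /G_Delta /Gaco_Delta /= lin_ext_basis lin_ext_Theta.
apply/ffunP=> -[A B].
(* The condition for [H] to contribute to the coefficient of [(A, B)] on the right-hand side. *)
pose RAB H := [&& is_ideal (aco_val H) J, A == aco_induced H I & B == aco_induced H J].
transitivity (\sum_(H | is_orientation G (aco_val H)) (RAB H)%:R : K^o); last first.
  rewrite sum_ffunE; apply: eq_bigr => H _; rewrite /RAB; case: ifP => _.
    by rewrite ffunE xpair_eqE andTb.
  by rewrite ffunE.
transitivity ([&& is_ideal G J, is_orientation (mg_induced G I) (aco_val A) &
    is_orientation (mg_induced G J) (aco_val B)]%:R : K^o).
  case: ifP => _; last by rewrite linear0 ffunE.
  by rewrite tens_map_basis ffunE !Theta_basisE -natrM mulnb.
apply/esym/sum_indicator => [H H' GH GH'|].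
  case/and3P=> idH /eqP AH /eqP BH /and3P[idH' /eqP AH' /eqP BH'].
  case/is_orientationP: GH => _ adjH; case/is_orientationP: GH' => _ adjH'.
  (* Uniqueness: since [J] is an ideal of the orientation, adjacent pairs across the two parts can
     only point from [I] to [J]. *)
  have crossE (L : aco_graph T) : is_ideal (aco_val L) J ->
      adjacent (aco_val L) =2 adjacent G -> forall x y, x \in I -> y \in J ->
    is_arc (aco_val L) x y = adjacent G x y /\ is_arc (aco_val L) y x = false.
    move=> /forallP idL adjL x y xI yJ.
    have yx : is_arc (aco_val L) y x = false.
      apply/negP=> yx; have /forallP/(_ x)/implyP := idL y.
      by rewrite yJ => /(_ yx); apply: notIJ.
    by rewrite -adjL aco_adjacent yx orbF.
  apply: aco_eq => x y.
  have [xI|xJ] := orP (inIJ x); have [yI|yJ] := orP (inIJ y).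
  - have: is_arc (aco_val (aco_induced H I)) (exist _ x xI) (exist _ y yI)
        = is_arc (aco_val (aco_induced H' I)) (exist _ x xI) (exist _ y yI).
      by rewrite -AH AH'.
    by rewrite !induced_is_arc.
  - by rewrite (crossE _ idH adjH x y xI yJ).1 (crossE _ idH' adjH' x y xI yJ).1.
  - by rewrite (crossE _ idH adjH y x yI xJ).2 (crossE _ idH' adjH' y x yI xJ).2.
  - have: is_arc (aco_val (aco_induced H J)) (exist _ x xJ) (exist _ y yJ)
        = is_arc (aco_val (aco_induced H' J)) (exist _ x xJ) (exist _ y yJ).
      by rewrite -BH BH'.
    by rewrite !induced_is_arc.
apply/idP/existsP; last first.
  case=> H /andP[GH /and3P[idH /eqP-> /eqP->]]; rewrite (orientation_ideal GH idH) andTb.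
  case/is_orientationP: GH => arcH adjH.
  by apply/andP; split; apply/is_orientationP; split=> x y;
    rewrite ?induced_is_arc ?induced_adjacent //; apply: arcH.
case/and3P=> /forallP idG /is_orientationP[arcA adjA] /is_orientationP[arcB adjB].
have [rkA rkAb rkAP] := acyclic_rank (@aco_acyclic _ A).
have [rkB _ rkBP] := acyclic_rank (@aco_acyclic _ B).
pose GA := mg_relabel val_inj (aco_val A); pose GB := mg_relabel val_inj (aco_val B).
(* The glued orientation: [A] on [I], [B] on [J], and every adjacent pair across them directed from
   [I] to [J]. *)
pose e x y := [|| is_arc GA x y, is_arc GB x y | [&& x \in I, y \in J & adjacent G x y]].
have GAP x y : is_arc GA x y ->
    exists u v, [/\ x = val u, y = val v & is_arc (aco_val A) u v].
  by case/imsetP=> -[u v] uv [-> ->]; exists u, v.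
have GBP x y : is_arc GB x y ->
    exists u v, [/\ x = val u, y = val v & is_arc (aco_val B) u v].
  by case/imsetP=> -[u v] uv [-> ->]; exists u, v.
have nJ (u : {x | x \in I}) : (val u \in J) = false.
  by apply: (disjointFr dIJ); apply: valP.
have nI (u : {x | x \in J}) : (val u \in I) = false.
  by apply: (disjointFl dIJ); apply: valP.
have GA_J (u : {x | x \in J}) y : is_arc GA (val u) y = false
    /\ is_arc GA y (val u) = false.
  split; apply/negP=> /GAP[a [b [ea eb _]]].
    by have := nI u; rewrite ea (valP a).
  by have := nI u; rewrite eb (valP b).
have GB_I (u : {x | x \in I}) y : is_arc GB (val u) y = false
    /\ is_arc GB y (val u) = false.
  split; apply/negP=> /GBP[a [b [ea eb _]]].
    by have := nJ u; rewrite ea (valP a).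
  by have := nJ u; rewrite eb (valP b).
have eII (u v : {x | x \in I}) : e (val u) (val v) = is_arc (aco_val A) u v.
  by rewrite /e (GB_I u _).1 relabel_is_arc nJ andbF !orbF.
have eJJ (u v : {x | x \in J}) : e (val u) (val v) = is_arc (aco_val B) u v.
  by rewrite /e (GA_J u _).1 relabel_is_arc nI /= orbF.
have eIJ (u : {x | x \in I}) (v : {x | x \in J}) :
    e (val u) (val v) = adjacent G (val u) (val v).
  by rewrite /e (GA_J v _).2 (GB_I u _).1 (valP u) (valP v).
have eJI (u : {x | x \in J}) (v : {x | x \in I}) : e (val u) (val v) = false.
  by rewrite /e (GA_J u _).1 (GB_I v _).2 nI.
have splitIJ x :
  (exists u : {x | x \in I}, x = val u) \/ (exists u : {x | x \in J}, x = val u).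
  by case/orP: (inIJ x) => xI; [left | right]; exists (exist _ x xI).
(* Ranks on [I] are at most the size of [I], so this shift puts all of [J] above [I]. The default 0
   is never reached, as [I] and [J] cover the vertices. *)
pose rk x := if insub x is Some u then rkA u
  else if insub x is Some v then (#|{: {x | x \in I}}|.+1 + rkB v)%N else 0%N.
have rkI (u : {x | x \in I}) : rk (val u) = rkA u by rewrite /rk valK.
have rkJ (u : {x | x \in J}) : rk (val u) = (#|{: {x | x \in I}}|.+1 + rkB u)%N.
  by rewrite /rk insubN ?valK ?nI.
have [|H HE] := @aco_of_rank T e rk.
  move=> x y; case: (splitIJ x) => -[u ->]; case: (splitIJ y) => -[v ->].
  - by rewrite eII !rkI; apply: rkAP.
  - by rewrite rkI rkJ addSn ltnS => _; apply: leq_trans (rkAb u) (leq_addr _ _).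
  - by rewrite eJI.
  - by rewrite eJJ !rkJ ltn_add2l; apply: rkBP.
(* As [J] is an ideal of [G], arcs of [G] across the parts go from [I] to [J], in agreement with
   [e]. *)
have GJI (u : {x | x \in J}) (v : {x | x \in I}) : is_arc G (val u) (val v) = false.
  apply/negP=> uv; have /forallP/(_ (val v))/implyP := idG (val u).
  by rewrite (valP u) nJ => /(_ uv).
exists H; apply/andP; split.
  apply/is_orientationP; split=> x y; rewrite ?aco_adjacent !HE;
    case: (splitIJ x) => -[u ->]; case: (splitIJ y) => -[v ->].
  - by rewrite eII -induced_is_arc; apply: arcA.
  - by rewrite eIJ; apply: arc_adjacent.
  - by rewrite GJI.
  - by rewrite eJJ -induced_is_arc; apply: arcB.
  - by rewrite !eII -aco_adjacent adjA induced_adjacent.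
  - by rewrite eIJ eJI orbF.
  - by rewrite eIJ eJI adjacentC.
  - by rewrite !eJJ -aco_adjacent adjB induced_adjacent.
apply/and3P; split.
- apply/forallP=> x; apply/forallP=> y; rewrite HE.
  case: (splitIJ x) => -[u ->]; first by rewrite nJ.
  case: (splitIJ y) => -[v ->]; first by rewrite eJI andbF.
  by rewrite (valP v) implybT.
- by apply/eqP/aco_eq => u v; rewrite induced_is_arc HE eII.
- by apply/eqP/aco_eq => u v; rewrite induced_is_arc HE eJJ.
Qed.

(** An adjacent pair across classes is directed one way or the other in [H]; going against the arc
    of the quotient would create a 2-cycle there. So the quotient determines the arcs of [H] between
    classes. *)
Lemma quo_arc_orientation (T : finType) (r : rel T) (G : mixed_graph T)
    (H : aco_graph T) x y :
  equivalence_rel r -> is_orientation G (aco_val H) ->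
  acyclic (mg_quo r (aco_val H)) -> ~~ r x y ->
  is_arc (aco_val H) x y =
    adjacent G x y && is_arc (mg_quo r (aco_val H)) (cl r x) (cl r y).
Proof.
move=> eqr /is_orientationP[_ adjH] acQ rxy.
have quo_arc u v : is_arc (aco_val H) u v -> ~~ r u v ->
    is_arc (mg_quo r (aco_val H)) (cl r u) (cl r v).
  by move=> uv ruv; apply/quo_is_arcP; exists u, v; rewrite cl_eq.
apply/idP/andP=> [xy|[]]; first by rewrite -adjH arc_adjacent ?quo_arc.
rewrite -adjH aco_adjacent => /orP[//|yx] Qxy.
have := acyclic_arcC acQ Qxy; rewrite quo_arc //.
by rewrite (equivalence_sym eqr).
Qed.

Lemma Theta_delta (T : finType) (r : rel T) (G : mixed_graph T) :
  equivalence_rel r ->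
  tens_map (Theta K (classes r)) (Theta K T) (G_delta K r (basis K G))
  = Gaco_delta K r (Theta K T (basis K G)).
Proof.
move=> eqr.
rewrite /G_delta /Gaco_delta /= lin_ext_basis lin_ext_Theta.
apply/ffunP=> -[Q R].
(* Acyclicity of the quotient follows from its equality with the acyclic graph [Q]. The equality is
   between underlying graphs, because [aco_quo] takes a proof of acyclicity. *)
pose QR H := [&& connected_classes r (aco_val H),
  aco_val Q == mg_quo r (aco_val H) & R == aco_restr r H].
transitivity (\sum_(H | is_orientation G (aco_val H)) (QR H)%:R : K^o); last first.
  rewrite sum_ffunE; apply: eq_bigr => H _; rewrite /QR.
  case: ifP => _; last by rewrite ffunE.
  case: acyclic_dec => [acQ|nacQ]; first by rewrite ffunE xpair_eqE -val_eqE andTb.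
  rewrite ffunE; case: eqP => // QE; case: nacQ; rewrite -QE.
  exact: aco_acyclic.
transitivity ([&& connected_classes r G, is_orientation (mg_quo r G) (aco_val Q) &
    is_orientation (mg_restr r G) (aco_val R)]%:R : K^o).
  case: ifP => _; last by rewrite linear0 ffunE.
  by rewrite tens_map_basis ffunE !Theta_basisE -natrM mulnb.
apply/esym/sum_indicator => [H H' GH GH'|].
  case/and3P=> _ /eqP QH /eqP RH /and3P[_ /eqP QH' /eqP RH'].
  have acH : acyclic (mg_quo r (aco_val H)) by rewrite -QH; apply: aco_acyclic.
  have acH' : acyclic (mg_quo r (aco_val H')) by rewrite -QH'; apply: aco_acyclic.
  (* Arcs inside classes are read off [R], arcs between classes off [Q]. *)
  apply: aco_eq => x y; case: (boolP (r x y)) => rxy; last first.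
    by rewrite !(quo_arc_orientation (r := r) (G := G)) // -QH -QH'.
  have: is_arc (aco_val (aco_restr r H)) x y = is_arc (aco_val (aco_restr r H')) x y.
    by rewrite -RH RH'.
  by rewrite !restr_is_arc rxy !andbT.
apply/idP/existsP; last first.
  case=> H /andP[/is_orientationP[arcH adjH] /and3P[conn /eqP QH /eqP RH]].
  rewrite -(connected_classes_adjacent _ adjH) conn andTb; apply/andP; split.
    apply/is_orientationP; rewrite QH; split=> C D.
      case/quo_is_arcP=> x [y [Cx Dy CD /arcH xy]].
      by apply/quo_is_arcP; exists x, y.
    by apply/quo_adjacentP/quo_adjacentP=> -[x [y [Cx Dy CD xy]]]; exists x, y;
      rewrite adjH in xy *.
  rewrite RH; apply/is_orientationP; split=> x y; last by rewrite !restr_adjacent ?adjH.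
  by rewrite !restr_is_arc => /andP[/arcH -> ->].
case/and3P=> conn /is_orientationP[arcQ adjQ] /is_orientationP[arcR adjR].
have [rkQ _ rkQP] := acyclic_rank (@aco_acyclic _ Q).
have [rkR rkRb rkRP] := acyclic_rank (@aco_acyclic _ R).
(* The glued orientation follows [R] inside classes and [Q] between them. The adjacency condition
   keeps an arc of [Q] from joining all members of its two classes. *)
pose e x y := adjacent G x y &&
  if r x y then is_arc (aco_val R) x y else is_arc (aco_val Q) (cl r x) (cl r y).
(* Lexicographic rank: [rkR] stays below the factor [#|T|.+1], so an increase of the rank in [Q]
   outweighs any change of rank in [R]. *)
have [|H HE] := @aco_of_rank T e (fun x => rkQ (cl r x) * #|T|.+1 + rkR x)%N.
  move=> x y /andP[_]; case: ifP => rxy xy.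
    have /eqP -> : cl r x == cl r y by rewrite cl_eq.
    by rewrite ltn_add2l rkRP.
  apply: (@leq_trans ((rkQ (cl r x)).+1 * #|T|.+1)).
    by rewrite mulSn addnC ltn_add2r ltnS.
  by apply: leq_trans (leq_addr _ _); rewrite leq_mul2r rkQP.
have adjH : adjacent (aco_val H) =2 adjacent G.
  move=> x y; rewrite aco_adjacent !HE /e (adjacentC G y x) -andb_orr.
  case Gxy: (adjacent G x y) => //=; rewrite (equivalence_sym eqr y x).
  case: (boolP (r x y)) => rxy; rewrite -aco_adjacent ?adjR ?adjQ.
    by rewrite restr_adjacent // Gxy.
  by apply/quo_adjacentP; exists x, y; rewrite cl_eq.
exists H; apply/andP; split.
  apply/is_orientationP; split=> // x y xy.
  rewrite HE /e arc_adjacent //=; case: (boolP (r x y)) => rxy.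
    by apply: arcR; rewrite restr_is_arc xy.
  by apply: arcQ; apply/quo_is_arcP; exists x, y; rewrite cl_eq.
rewrite /QR (connected_classes_adjacent _ adjH) conn andTb; apply/andP; split; apply/eqP.
  apply: oriented_eq; [exact: aco_oriented | exact: quo_oriented | move=> C D].
  apply/idP/quo_is_arcP=> [CD|[x [y [-> -> xy]]]].
    (* An arc of [Q] lies below some adjacent pair of [G], because [Q] has the adjacency of the
       quotient, and [e] directs that pair along [Q]. *)
    have: adjacent (mg_quo r G) C D by rewrite -adjQ arc_adjacent.
    case/quo_adjacentP=> x [y [Cx Dy ne xy]]; exists x, y; split=> //.
    by rewrite HE /e xy -(cl_eq eqr) -Cx -Dy (negPf ne).
  by rewrite HE /e -(cl_eq eqr) (negPf xy) => /andP[].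
apply: aco_eq => x y; rewrite restr_is_arc HE /e.
apply/idP/idP=> [xy|/andP[/andP[_ +] rxy]]; last by rewrite rxy.
(* Arcs of [R] join only adjacent vertices of [G] in a common class. *)
have: adjacent (mg_restr r G) x y by rewrite -adjR arc_adjacent.
by rewrite restr_adjacent // => /andP[-> ->]; rewrite xy.
Qed.

(** On a nonempty vertex set every term vanishes; on the empty one there is exactly one acyclic
    orientation. *)
Lemma Theta_eps_Delta (T : finType) (G : mixed_graph T) :
  Gaco_eps_Delta K T (Theta K T (basis K G)) = G_eps_Delta K T (basis K G).
Proof.
rewrite [LHS]lin_ext_Theta [RHS]lin_ext_basis.
apply: sum_indicator => [H H' _ _ /eqP/card0_eq T0 _|].
  by apply: aco_eq => x; have := T0 x.
apply/idP/existsP=> [T0|[H /andP[]] //].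
have T_empty (x : T) : False by have := card0_eq (eqP T0) x.
have [H _] := @aco_of_rank T (fun _ _ => false) (fun=> 0%N) (fun _ _ => id).
by exists H; rewrite T0 andbT; apply/is_orientationP; split=> x; case: (T_empty x).
Qed.

(** Phrased through adjacency, the condition visibly passes between a graph and its orientations. *)
Lemma edgelessP (T : finType) (G : mixed_graph T) :
  reflect (forall x y, adjacent G x y = false)
          ((edges G == set0) && (arcs G == set0)).
Proof.
apply: (iffP andP) => [[/eqP E0 /eqP A0] x y|nadj].
  by rewrite /adjacent /is_edge /is_arc E0 A0 !inE.
split; apply/eqP/setP; [move=> e | case=> x y]; rewrite in_set0; apply/negP.
  move=> eG; have /eqP/cards2P[x [y [_ eE]]] := card_edge eG.
  by have := nadj x y; rewrite /adjacent /is_edge -eE eG.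
by move=> xy; have := nadj x y; rewrite arc_adjacent.
Qed.

(** A graph with an edgeless orientation is itself edgeless, and then the edgeless graph is its only
    orientation. *)
Lemma Theta_eps_delta (T : finType) (G : mixed_graph T) :
  Gaco_eps_delta K T (Theta K T (basis K G)) = G_eps_delta K T (basis K G).
Proof.
rewrite [LHS]lin_ext_Theta [RHS]lin_ext_basis.
apply: sum_indicator => [H H' _ _ /edgelessP H0 /edgelessP H'0|].
  apply: aco_eq => x y.
  have arcF (L : aco_graph T) : (forall x y, adjacent (aco_val L) x y = false) ->
      is_arc (aco_val L) x y = false.
    by move=> L0; apply/negP=> /arc_adjacent; rewrite L0.
  by rewrite !arcF.
apply/edgelessP/existsP=> [G0|[H /andP[/is_orientationP[_ adjH] /edgelessP H0]] x y].
  have [H HE] := @aco_of_rank T (fun _ _ => false) (fun=> 0%N) (fun _ _ => id).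
  have H0 x y : adjacent (aco_val H) x y = false by rewrite aco_adjacent !HE.
  exists H; apply/andP; split; last exact/edgelessP.
  apply/is_orientationP; split=> x y; last by rewrite G0.
  by move/arc_adjacent; rewrite G0.
by rewrite -adjH.
Qed.

End Compatibility.

Theorem theorem4p2 (K : fieldType) :
  (* Theta is a morphism of species *)
  (forall (S T : finType) (f : S -> T) (bijf : bijective f) (G : mixed_graph S),
     Theta K T (G_relabel K bijf (basis K G))
     = Gaco_relabel K bijf (Theta K S (basis K G))) /\
  (* products and units *)
  (forall (X Y : finType) (G : mixed_graph X) (H : mixed_graph Y),
     Theta K (X + Y)%type (G_mul K X Y (tens (basis K G) (basis K H)))
     = Gaco_mul K X Y (tens (Theta K X (basis K G)) (Theta K Y (basis K H)))) /\
  Theta K void (basis K mg_one) = basis K aco_one /\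
  (* Delta *)
  (forall (T : finType) (I J : {set T}) (G : mixed_graph T),
     I :|: J = [set: T] -> [disjoint I & J] ->
     tens_map (Theta K {x | x \in I}) (Theta K {x | x \in J})
       (G_Delta K I J (basis K G))
     = Gaco_Delta K I J (Theta K T (basis K G))) /\
  (* delta *)
  (forall (T : finType) (r : rel T) (G : mixed_graph T),
     equivalence_rel r ->
     tens_map (Theta K (classes r)) (Theta K T) (G_delta K r (basis K G))
     = Gaco_delta K r (Theta K T (basis K G))) /\
  (* counits *)
  (forall (T : finType) (G : mixed_graph T),
     Gaco_eps_Delta K T (Theta K T (basis K G)) = G_eps_Delta K T (basis K G)) /\
  (forall (T : finType) (G : mixed_graph T),
     Gaco_eps_delta K T (Theta K T (basis K G)) = G_eps_delta K T (basis K G)).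
Proof.
split; first exact: Theta_relabel.
split; first exact: Theta_mul.
split; first exact: Theta_one.
split; first exact: Theta_Delta.
split; first exact: Theta_delta.
by split; [exact: Theta_eps_Delta | exact: Theta_eps_delta].
Qed.
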